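(* The following equalities hold: (a) $\mathrm{PrePer}(x^2)\cap\mathbb{Q}^{\mathrm{tr}}=\{\pm1,0\}$. (b) $\mathrm{PrePer}\left(x^2+\frac14\right)\cap\mathbb{Q}^{\mathrm{tr}}=\left\{\pm\frac12\right\}$. (c) $\mathrm{PrePer}(x^2-1)\cap\mathbb{Q}^{\mathrm{tr}}=\left\{0,\pm1,\pm\sqrt2,\frac{-1\pm\sqrt5}{2},\frac{1\pm\sqrt5}{2}\right\}$. (d) $\mathrm{PrePer}\left(x^2+\frac15\right)\cap\mathbb{Q}^{\mathrm{tr}}=\left\{\frac{-1\pm\sqrt5}{2\sqrt5},\frac{1\pm\sqrt5}{2\sqrt5}\right\}$.
   Context: For a polynomial $f$ with coefficients in $\overline{\mathbb{Q}}$, $f^n$ denotes the $n$-fold composition of $f$ with itself ($f^0$ is the identity). An algebraic number $\alpha\in\overline{\mathbb{Q}}$ is a preperiodic point of $f$ if $f^n(\alpha)=f^m(\alpha)$ for some integers $0\le m<n$. $\mathrm{PrePer}(f)$ denotes the set of all preperiodic points of $f$ in $\overline{\mathbb{Q}}$. An algebraic number $\alpha$ is totally real if its minimal polynomial over $\mathbb{Q}$ splits completely over $\mathbb{R}$ (equivalently, every complex embedding $\mathbb{Q}(\alpha)\hookrightarrow\mathbb{C}$ has image contained in $\mathbb{R}$). $\mathbb{Q}^{\mathrm{tr}}$ denotes the set of all totally real algebraic numbers. *)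

(* Defs.v *)
From HB Require Import structures.
From mathcomp Require Import all_boot all_order all_algebra all_field.
From mathcomp Require Import boolp classical_sets reals.

Set Implicit Arguments.
Unset Strict Implicit.
Unset Printing Implicit Defensive.

Import Order.TTheory GRing.Theory Num.Theory.

Local Open Scope classical_set_scope.
Local Open Scope ring_scope.

Definition poly_iter (f : {poly algC}) (n : nat) : {poly algC} :=
  iter n (fun g => f \Po g) 'X.

Definition PrePer (f : {poly algC}) : set algC :=
  [set alpha | exists m n : nat,
     (m < n)%N /\ (poly_iter f n).[alpha] = (poly_iter f m).[alpha]].

(* minCpoly alpha is the minimal polynomial over Q with its coefficients
   already embedded in algC; p is the same polynomial over rat, which can
   then be mapped into R. *)
Definition totally_real (R : realType) (alpha : algC) : Prop :=
  exists2 p : {poly rat},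
    map_poly ratr p = minCpoly alpha &
    exists s : seq R, map_poly ratr p = \prod_(a <- s) ('X - a%:P).

Definition Qtr (R : realType) : set algC := [set alpha | totally_real R alpha].

(* Main.v *)
(* A totally real alpha shares its rational polynomial relations with a real
   number a, a root in R of its minimal polynomial, so a is preperiodic whenever
   alpha is, and it suffices to constrain a by a rational equation.

   For f = X^2 + c with c >= 0, f is increasing and injective on [0, +oo), so
   f(a) is a fixed point and a = +-f(a).

   For f = X^2 - 1, monotonicity of f o f on [-1, 0] and of f on [1, +oo) shows
   that the real periodic points are 0, -1 and the two fixed points.  Pulling
   back, an orbit leaving the nine listed points passes through some x = f^k(a)
   with (x^2 - 1)^2 = 2 or x^4 - x^2 - 1 = 0.  Then x^2 is an irrational root of
   a rational quadratic whose other root, a conjugate of x^2, is negative, so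
   some conjugate of x is not real. *)
Require Import Defs.
From HB Require Import structures.
From mathcomp Require Import all_boot all_order all_algebra all_field.
From mathcomp Require Import boolp classical_sets reals.
From mathcomp Require Import ring lra.

Set Implicit Arguments.
Unset Strict Implicit.
Unset Printing Implicit Defensive.

Import Order.TTheory GRing.Theory Num.Theory.

Local Open Scope classical_set_scope.
Local Open Scope ring_scope.

(** * Periodic points of quadratic maps over an ordered field *)

Lemma iter_periodicM (T : Type) (f : T -> T) (x : T) (N k : nat) :
  iter N f x = x -> iter (k * N) f x = x.
Proof. by move=> per; elim: k => // k IHk; rewrite mulSn iterD IHk. Qed.

(** The orbit of [x] is monotone in the direction of its first step. Since it returns to [x] after
    [N.+1] steps, [f x] is squeezed between [x] and [x]. *)
Lemma monotone_periodic_fixed (R : realFieldType) (f : R -> R)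
    (D : R -> Prop) (N : nat) (x : R) :
  (forall y, D y -> D (f y)) ->
  (forall y z, D y -> D z -> y <= z -> f y <= f z) ->
  D x -> iter N.+1 f x = x -> f x = x.
Proof.
move=> Df fmono Dx per.
have Dk k : D (iter k f x) by elim: k => //= k; apply: Df.
have [le|/ltW le] := lerP x (f x).
- have step k : iter k f x <= iter k.+1 f x.
    by elim: k => //= k IHk; apply: fmono => //; apply: (Dk k.+1).
  have ge k : f x <= iter k.+1 f x.
    by elim: k => // k IHk; apply: le_trans IHk (step _).
  by apply/eqP; rewrite eq_le le -{2}per ge.
- have step k : iter k.+1 f x <= iter k f x.
    by elim: k => //= k IHk; apply: fmono => //; apply: (Dk k.+1).
  have ge k : iter k.+1 f x <= f x.
    by elim: k => // k IHk; apply: le_trans (step _) IHk.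
  by apply/eqP; rewrite eq_le le -{1}per ge.
Qed.

Definition quad (K : pzRingType) (c x : K) : K := x ^+ 2 + c.

(** The product is [f (f a) - f a] for [f = quad c]. Values of [f] are nonnegative, so injectivity
    there cancels the preperiod, and monotonicity turns the periodic point [f a] into a fixed
    one. *)
Lemma preper_quad_ge0 (R : realFieldType) (c a : R) (m n : nat) :
  0 <= c -> (m < n)%N -> iter n (quad c) a = iter m (quad c) a ->
  (a ^+ 2 - a + c) * (a ^+ 2 + a + c) = 0.
Proof.
move=> c0 mn eqnm.
have q0 y : 0 <= quad c y by rewrite addr_ge0 ?sqr_ge0.
have qinj y z : 0 <= y -> 0 <= z -> quad c y = quad c z -> y = z.
  by move=> y0 z0 /addIr /eqP; rewrite eqrXn2 // => /eqP.
have it0 k : 0 <= iter k (quad c) (quad c a) by case: k => [|k]; apply: q0.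
(* The orbit is started at [quad c a] because [a] itself may be negative, outside the domain of
   injectivity. *)
have per : iter (n - m) (quad c) (quad c a) = quad c a.
  have e : iter (m + (n - m)) (quad c) (quad c a) = iter m (quad c) (quad c a).
    by rewrite subnKC 1?ltnW // -!iterSr /= eqnm.
  elim: m {mn eqnm} (n - m)%N e => // m IHm k /= e.
  by apply: IHm; apply: qinj e.
have fixed : quad c (quad c a) = quad c a.
  move: per; rewrite -[(n - m)%N]prednK ?subn_gt0 //.
  apply: (@monotone_periodic_fixed _ _ (fun y => 0 <= y)) => // y z y0 z0 yz.
  by rewrite lerD2r lerXn2r.
have -> : (a ^+ 2 - a + c) * (a ^+ 2 + a + c) =
          quad c (quad c a) - quad c a by rewrite /quad; ring.
by rewrite fixed subrr.
Qed.

(** The quartic is [f (f y) - y]. Either the orbit meets [[-1, 1]], hence stays in [[-1, 0]] from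
    the next step on, where [f] decreases and [f \o f] increases; or it stays in [|x| > 1], and then
    in [x > 1], where [f] increases. *)
Lemma periodic_basilica (R : realFieldType) (y : R) (N : nat) :
  iter N.+1 (quad (-1)) y = y -> y * (y + 1) * (y ^+ 2 - y - 1) = 0.
Proof.
move=> per; set f := quad (-1) : R -> R.
have fE x : f x = x ^+ 2 - 1 by [].
suff ffy : f (f y) = y.
  have -> : y * (y + 1) * (y ^+ 2 - y - 1) = f (f y) - y by rewrite !fE; ring.
  by rewrite ffy subrr.
have [[k yk]|big] := pselect (exists k, `|iter k f y| <= 1).
- have I_inv x : -1 <= x <= 0 -> -1 <= f x <= 0 by rewrite fE => ?; nra.
  have yk1 : -1 <= iter k.+1 f y <= 0.
    by move: yk; rewrite iterS fE ler_norml => ?; nra.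
  have Ij j : -1 <= iter (j + k.+1) f y <= 0.
    by elim: j => // j IHj; rewrite addSn; apply: I_inv.
  (* The extra [k.+1 * N] steps complete [k.+1] to a multiple of the period [N.+1], which brings the
     orbit back to [y]. *)
  have Iy : -1 <= y <= 0.
    have := Ij (k.+1 * N)%N.
    by rewrite addnC -mulnS iter_periodicM.
  have ffper : iter N.+1 (f \o f) y = y.
    have it2 k' x : iter k' (f \o f) x = iter (k' * 2) f x.
      by elim: k' => // k' IHk'; rewrite iterS IHk' mulSn.
    by rewrite it2 mulnC iter_periodicM.
  apply: (@monotone_periodic_fixed _ _ (fun x => -1 <= x <= 0)
           _ _ _ _ Iy ffper) => [x Ix|u v Iu Iv uv] /=.
    exact: (I_inv _ (I_inv _ Ix)).
  have anti z w : -1 <= z <= 0 -> -1 <= w <= 0 -> z <= w -> f w <= f z.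
    by rewrite !fE => *; nra.
  by apply: (anti); [apply: I_inv|apply: I_inv|apply: anti].
- have big1 k : 1 < `|iter k f y|.
    by rewrite ltNge; apply/negP => h; apply: big; exists k.
  (* The sign is known only after one step, since [y] could be below [-1]; periodicity then settles
     [y] itself. *)
  have pos1 k : 1 < iter k.+1 f y.
    have f0 : 0 <= iter k.+1 f y.
      by rewrite iterS fE subr_ge0 -real_normK ?num_real // exprn_ege1 // ltW.
    by have := big1 k.+1; rewrite ger0_norm.
  have pos k : 1 < iter k f y.
    by case: k => [|k]; rewrite ?pos1 //= -per pos1.
  suff fy : f y = y by rewrite !fy.
  apply: (@monotone_periodic_fixed _ _ (fun x => forall k, 1 < iter k f x)
           _ _ _ _ pos per) => [x Dx k|u v].
    by rewrite -iterSr; apply: Dx.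
  by move=> /(_ 0%N) /= u1 /(_ 0%N) /= v1 uv; rewrite /f /quad; nra.
Qed.

(** * Irrationality of square roots of primes *)

Lemma prime_not_rat_square (p : nat) (x : rat) : prime p -> x ^+ 2 != p%:R.
Proof.
move=> pr; apply/eqP => x2.
have eqQ : (numq x ^+ 2)%:~R = (p%:Z * denq x ^+ 2)%:~R :> rat.
  rewrite rmorphXn [RHS]rmorphM rmorphXn /= -pmulrn -x2 numqE; ring.
have /(congr1 absz) := intr_inj eqQ.
rewrite abszM !abszX absz_nat => eqN.
have nz : (0 < `|denq x|)%N by rewrite absz_gt0 denq_eq0.
(* The exponent of [p] is even on the left and odd on the right. *)
have := congr1 (odd \o logn p) eqN => /=.
by rewrite !(lognX, lognM) ?expn_gt0 ?nz ?prime_gt0 // (logn_prime p pr) eqxx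
  oddD !oddM.
Qed.

(** * Rational polynomials, conjugates and total reality *)

Section RationalPolynomials.

Local Notation "p ^^" := (map_poly ratr p) (at level 2).

(** The gcd of [p] and [q] also vanishes at [a], so it is not constant and is associated to [p]. As
    the right side does not mention [K], roots of [p] in different fields satisfy the same rational
    relations. *)
Lemma root_irreducible (K : numFieldType) (p q : {poly rat}) (a : K) :
  irreducible_poly p -> root p^^ a -> root q^^ a = (p %| q).
Proof.
move=> [sp irr] pa0; apply/idP/idP => [qa0|/dvdpP[e ->]]; last first.
  by rewrite rmorphM rootM pa0 orbT.
have ga0 : root (gcdp p q)^^ a by rewrite gcdp_map root_gcd pa0.
have p0 : p != 0 by rewrite -size_poly_gt0 ltnW.
have : gcdp p q %= p.
  apply: irr; last exact: dvdp_gcdl.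
  apply: contraTN ga0 => /size_poly1P[c c0 ->].
  by rewrite map_polyC rootC /= fmorph_eq0.
by move/eqp_dvdl <-; apply: dvdp_gcdr.
Qed.

Lemma totally_real_min (R : realType) (alpha : algC) :
  totally_real R alpha -> exists (p : {poly rat}) (s : seq R),
  [/\ p^^ = \prod_(a <- s) ('X - a%:P), irreducible_poly p & root p^^ alpha].
Proof.
move=> [p pE [s sE]]; exists p, s; rewrite sE.
have [p' [p'E _ p'P]] := minCpolyP alpha.
have pp' : p = p'.
  apply: (map_inj_poly (fmorph_inj (@ratr algC)) (rmorph0 _)).
  by rewrite /= pE p'E.
have palpha : root p^^ alpha by rewrite p'P -pp'.
have p0 : p != 0 by rewrite -(map_poly_eq0 (@ratr algC)) pE minCpoly_eq0.
split=> //; split=> [|q].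
  rewrite -(size_map_poly (@ratr algC)); apply: root_size_gt1 palpha.
  by rewrite map_poly_eq0.
(* Write [p = e * q]. If [alpha] were a root of [e], minimality would give [p %| e], impossible by
   degree as [q] is not constant. *)
move=> sq /[dup] qp /dvdpP[e ep].
have q0 : q != 0 by apply: contraNneq p0 => q0; rewrite ep q0 mulr0.
have e0 : e != 0 by apply: contraNneq p0 => e0; rewrite ep e0 mul0r.
move: palpha; rewrite ep rmorphM rootM !p'P -pp' => /orP[|pq]; last first.
  by rewrite /eqp -ep qp.
move/(dvdp_leq e0); rewrite ep size_mul // leqNgt => /negP[].
rewrite -subn1 -addnBA ?size_poly_gt0 // -[X in (X < _)%N]addn0 ltn_add2l.
by rewrite subn_gt0 ltn_neqAle eq_sym sq size_poly_gt0.
Qed.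

(** The minimal polynomial divides a quadratic that splits over [R], and a monic divisor of a
    product of linear factors is a subproduct. *)
Lemma totally_real_quadratic (R : realType) (u v : rat) (alpha : algC) :
  alpha ^+ 2 = ratr u * alpha + ratr v -> 0 <= u ^+ 2 + 4 * v ->
  totally_real R alpha.
Proof.
move=> alpha2 disc.
have [p [pE _ pP]] := minCpolyP alpha; exists p => //.
pose d : R := Num.sqrt (ratr (u ^+ 2 + 4 * v)).
have d2 : d ^+ 2 = (ratr u) ^+ 2 + 4 * ratr v.
  by rewrite sqr_sqrtr ?ler0q // rmorphD rmorphM rmorphXn /= ratr_nat.
pose q : {poly rat} := 'X^2 - u *: 'X - v%:P.
have qE (K : numFieldType) : q^^ = 'X^2 - (ratr u)%:P * 'X - (ratr v)%:P :> {poly K}.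
  by rewrite /q !rmorphB /= map_polyZ map_polyXn map_polyX map_polyC mul_polyC.
have pq : p %| q.
  by rewrite -pP qE /root !hornerE alpha2; apply/eqP; ring.
pose r : seq R := [:: (ratr u + d) / 2; (ratr u - d) / 2].
have qR : q^^ = \prod_(a <- r) ('X - a%:P).
  rewrite qE !big_cons big_nil mulr1.
  set A := _ / 2; set B := _ / 2.
  have -> : ratr u = A + B by rewrite /A /B; field.
  have -> : ratr v = - (A * B).
    have -> : A * B = (ratr u ^+ 2 - d ^+ 2) / 4 by rewrite /A /B; field.
    by rewrite d2; field.
  by rewrite !(rmorphD, rmorphN, rmorphM) /=; ring.
have : p^^ %| \prod_(a <- r) ('X - a%:P) by rewrite -qR dvdp_map.
case/dvdp_prod_XsubC => m; rewrite eqp_monic ?monic_prod_XsubC //.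
  by move/eqP => ->; exists (mask m r).
by rewrite map_monic; rewrite -(map_monic (@ratr algC)) -pE minCpoly_monic.
Qed.

(* Over R write X^2 - uX - v = (X - B)(X - C) with C < 0 < B.  As p splits over
   R it is coprime to h^2 - C, so it divides h^2 - B, and the remainder of h^2
   modulo p, which is rational, must be the constant B. *)
Lemma split_root_square (R : realType) (p h : {poly rat}) (s : seq R)
    (u v : rat) :
  p^^ = \prod_(a <- s) ('X - a%:P) -> (1 < size p)%N -> 0 < v ->
  p %| (h ^+ 2) ^+ 2 - u *: h ^+ 2 - v%:P ->
  exists b : rat, b ^+ 2 = u * b + v.
Proof.
move=> pE sp v0 pdvd.
have v0R : 0 < ratr v :> R by rewrite ltr0q.
pose d : R := Num.sqrt (ratr u ^+ 2 + 4 * ratr v).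
have d2 : d ^+ 2 = ratr u ^+ 2 + 4 * ratr v.
  by rewrite sqr_sqrtr // addr_ge0 ?sqr_ge0 // mulr_ge0 // ltW.
pose B : R := (ratr u + d) / 2; pose C : R := (ratr u - d) / 2.
have BC : B * C = - ratr v.
  rewrite /B /C; have -> : ratr v = (d ^+ 2 - ratr u ^+ 2) / 4 :> R.
    by rewrite d2; field.
  by field.
have BDC : B + C = ratr u by rewrite /B /C; field.
have C0 : C < 0.
  have d0 : 0 <= d by rewrite sqrtr_ge0.
  by rewrite /C; nra.
have factor : ((h ^+ 2) ^+ 2 - u *: h ^+ 2 - v%:P)^^
    = (h^^ ^+ 2 - B%:P) * (h^^ ^+ 2 - C%:P).
  rewrite !rmorphB /= map_polyZ map_polyC !rmorphXn /= -mul_polyC -BDC.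
  have -> : ratr v = - (B * C) by rewrite BC opprK.
  by rewrite !(rmorphD, rmorphN, rmorphM) /=; ring.
have cop : coprimep p^^ (h^^ ^+ 2 - C%:P).
  rewrite pE; elim: s {pE} => [|a s IHs]; first by rewrite big_nil coprime1p.
  rewrite big_cons coprimepMl IHs andbT coprimep_sym coprimep_XsubC.
  rewrite /root !hornerE gt_eqF // subr_gt0.
  by apply: lt_le_trans C0 _; rewrite sqr_ge0.
have : p^^ %| h^^ ^+ 2 - B%:P by rewrite -(Gauss_dvdpl _ cop) -factor dvdp_map.
have p0 : p != 0 by rewrite -size_poly_gt0 ltnW.
rewrite -rmorphXn /= (divp_eq (h ^+ 2) p) rmorphD rmorphM /= -addrA.
rewrite dvdp_addr ?dvdp_mull // => pr.
have : ((h ^+ 2) %% p)^^ - B%:P == 0.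
  apply: contraLR pr => nz; apply/negP => /(dvdp_leq nz).
  rewrite leqNgt => /negP[]; rewrite (leq_ltn_trans (size_polyD _ _)) //.
  rewrite gtn_max size_polyN !size_map_poly ltn_modp p0.
  by rewrite (leq_ltn_trans (size_polyC_leq1 _)).
rewrite subr_eq0 => /eqP /(congr1 (fun g : {poly R} => g`_0)).
rewrite coef_map coefC /= => bB; exists ((h ^+ 2 %% p)`_0).
apply: (fmorph_inj (@ratr R)).
rewrite rmorphXn rmorphD rmorphM /= bB -BDC.
have -> : ratr v = - (B * C) by rewrite BC opprK.
by ring.
Qed.

(** * Iterates as rational polynomials, and passage to a real conjugate *)

Definition quad_iter (c : rat) (n : nat) : {poly rat} :=
  iter n (fun g => g ^+ 2 + c%:P) 'X.

Lemma horner_quad_iter (K : numFieldType) (c : rat) (n : nat) (x : K) :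
  (quad_iter c n)^^.[x] = iter n (quad (ratr c)) x.
Proof.
elim: n => [|n IHn]; first by rewrite map_polyX hornerX.
by rewrite /= rmorphD rmorphXn /= map_polyC !hornerE IHn.
Qed.

Lemma horner_poly_iter (f : {poly algC}) (n : nat) (x : algC) :
  (poly_iter f n).[x] = iter n (horner f) x.
Proof.
by elim: n => [|n IHn]; rewrite ?hornerX //= horner_comp IHn.
Qed.

Lemma PrePer_quadP (c alpha : algC) :
  PrePer ('X^2 + c%:P) alpha <->
  exists m n, (m < n)%N /\ iter n (quad c) alpha = iter m (quad c) alpha.
Proof.
have E k : (poly_iter ('X^2 + c%:P) k).[alpha] = iter k (quad c) alpha.
  by rewrite horner_poly_iter; apply: eq_iter => x; rewrite !hornerE.
by split=> -[m [n [mn eq_mn]]]; exists m, n; move: eq_mn; rewrite !E.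
Qed.

Lemma totally_real_preper_conj (R : realType) (c : rat) (alpha : algC) :
  PrePer ('X^2 + (ratr c)%:P) alpha -> totally_real R alpha ->
  exists (p : {poly rat}) (s : seq R) (a : R),
  [/\ p^^ = \prod_(a <- s) ('X - a%:P), (1 < size p)%N,
      (forall q, root q^^ alpha = (p %| q)),
      (forall q, root q^^ a = (p %| q)) &
      exists m n, (m < n)%N /\
        iter n (quad (ratr c)) a = iter m (quad (ratr c)) a].
Proof.
move=> /PrePer_quadP[m [n [mn eq_mn]]] /totally_real_min[p [s [pE irr pa0]]].
have [sp _] := irr.
case: s pE => [|a s] pE.
  by move: sp; rewrite -(size_map_poly (@ratr R)) pE big_nil size_poly1.
have pa : root p^^ a by rewrite pE big_cons rootM root_XsubC eqxx.
exists p, (a :: s), a; split=> //.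
- by move=> q; apply: root_irreducible.
- by move=> q; apply: root_irreducible.
(* Preperiodicity is the vanishing of one rational polynomial, so it passes from [alpha] to [a]
   through divisibility by [p]. *)
have root_mn (K : numFieldType) (x : K) :
    root (quad_iter c n - quad_iter c m)^^ x =
    (iter n (quad (ratr c)) x == iter m (quad (ratr c)) x).
  by rewrite /root rmorphB hornerD hornerN !horner_quad_iter subr_eq0.
exists m, n; split=> //; apply/eqP.
rewrite -root_mn (root_irreducible _ irr pa) -(root_irreducible _ irr pa0).
by rewrite root_mn eq_mn.
Qed.

(** * Totally real preperiodic points as roots of explicit polynomials *)

Lemma PrePer_Qtr_quad (R : realType) (c : rat) (alpha : algC) :
  0 <= c <= 1 / 4 ->
  (PrePer ('X^2 + (ratr c)%:P) `&` Qtr R) alpha <->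
  (alpha ^+ 2 - alpha + ratr c) * (alpha ^+ 2 + alpha + ratr c) = 0.
Proof.
move=> /andP[c0 c4]; split=> [[pre tr]|/eqP alphaP]; last first.
  split.
    apply/PrePer_quadP; exists 1%N, 2%N; split=> //=.
    by apply/eqP; rewrite -subr_eq0 -(eqP alphaP) /quad; apply/eqP; ring.
  move: alphaP; rewrite mulf_eq0 => /orP[] /eqP h.
    (* Both factors have discriminant [1 - 4 * c], nonnegative because [c <= 1 / 4]. *)
    apply: (@totally_real_quadratic R 1 (- c)); last by lra.
    by rewrite rmorph1 rmorphN /=; apply/eqP; rewrite -subr_eq0 -h; apply/eqP; ring.
  apply: (@totally_real_quadratic R (-1) (- c)); last by lra.
  by rewrite !rmorphN rmorph1 /=; apply/eqP; rewrite -subr_eq0 -h; apply/eqP; ring.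
have [p [s [a [_ _ palpha pa [m [n [mn eq_mn]]]]]]] :=
  totally_real_preper_conj pre tr.
pose q : {poly rat} := ('X^2 - 'X + c%:P) * ('X^2 + 'X + c%:P).
have qE (K : numFieldType) (x : K) :
    q^^.[x] = (x ^+ 2 - x + ratr c) * (x ^+ 2 + x + ratr c).
  by rewrite /q rmorphM !rmorphD rmorphN /= map_polyXn map_polyX map_polyC !hornerE.
rewrite -qE; apply/rootP; rewrite palpha -pa; apply/rootP; rewrite qE.
by apply: preper_quad_ge0 mn eq_mn; rewrite ler0q.
Qed.

Lemma PrePer_Qtr_basilica (R : realType) (alpha : algC) :
  (PrePer ('X^2 + (ratr (-1))%:P) `&` Qtr R) alpha <->
  alpha * (alpha ^+ 2 - 1) * (alpha ^+ 2 - 2) *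
    (alpha ^+ 2 - alpha - 1) * (alpha ^+ 2 + alpha - 1) = 0.
Proof.
split=> [[pre tr]|alphaP]; last first.
  split.
    (* The second iterate of each listed point has period dividing 2; the cofactor introduced below
       completes the polynomial to [f^4 - f^2]. *)
    apply/PrePer_quadP; exists 2%N, 4%N; split=> //=.
    rewrite rmorphN rmorph1 /quad; apply/eqP; rewrite -subr_eq0; apply/eqP.
    rewrite -[RHS](mulr0 (alpha * (alpha ^+ 2 - 1) * (alpha ^+ 4 - alpha ^+ 2 - 1))).
    by rewrite -alphaP; ring.
  have quadr (u v : rat) : 0 <= u ^+ 2 + 4 * v ->
      alpha ^+ 2 - ratr u * alpha - ratr v = 0 -> totally_real R alpha.
    move=> disc h; apply: (@totally_real_quadratic R u v) => //.
    by apply/eqP; rewrite -subr_eq0 -h; apply/eqP; ring.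
  move/eqP: alphaP; rewrite !mulf_eq0 -!orbA => /or4P[/eqP h|/eqP h|/eqP h|].
  - by apply: (quadr 0 0); [lra|rewrite ?h !rmorph0; ring].
  - by apply: (quadr 0 1); [lra|rewrite rmorph0 rmorph1 -[RHS]h; ring].
  - by apply: (quadr 0 2); [lra|rewrite rmorph0 ratr_nat -[RHS]h; ring].
  - case/orP=> /eqP h.
      by apply: (quadr 1 1); [lra|rewrite rmorph1 -[RHS]h; ring].
    by apply: (quadr (-1) 1); [lra|rewrite rmorphN rmorph1 -[RHS]h; ring].
have [p [s [a [pE sp palpha pa [m [n [mn eq_mn]]]]]]] :=
  totally_real_preper_conj pre tr.
pose P (K : numFieldType) (x : K) := x * (x ^+ 2 - 1) * (x ^+ 2 - 2) *
    (x ^+ 2 - x - 1) * (x ^+ 2 + x - 1).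
pose q : {poly rat} := 'X * ('X^2 - 1%:P) * ('X^2 - 2%:P) *
    ('X^2 - 'X - 1%:P) * ('X^2 + 'X - 1%:P).
have qE (K : numFieldType) (x : K) : q^^.[x] = P K x.
  rewrite /q !rmorphM !rmorphB !rmorphD /= !map_polyXn map_polyX !map_polyC.
  by rewrite /= !(ratr_nat _ 1, ratr_nat _ 2) !hornerE.
rewrite -/(P algC alpha) -qE; apply/rootP; rewrite palpha -pa; apply/rootP.
rewrite qE; pose x k := iter k (quad (-1)) a.
have xE k : x k = (quad_iter (-1) k)^^.[a].
  by rewrite horner_quad_iter rmorphN rmorph1.
have xS k : x k.+1 = x k ^+ 2 - 1 by [].
rewrite rmorphN rmorph1 -/(x n) -/(x m) in eq_mn.
(* Here [x k] is the value at [a] of a rational polynomial, which serves as [h] in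
   [split_root_square]. *)
have nosq k (u v : rat) : 0 < v ->
    (x k ^+ 2) ^+ 2 = ratr u * x k ^+ 2 + ratr v ->
    exists b : rat, b ^+ 2 = u * b + v.
  move=> v0 xk.
  apply: (@split_root_square R p (quad_iter (-1) k) s) pE sp v0 _.
  rewrite -pa /root !rmorphB /= map_polyZ map_polyC !rmorphXn /=.
  by rewrite !(hornerD, hornerN) hornerZ hornerC !horner_exp -xE xk; apply/eqP; ring.
have Pm : P R (x m) = 0.
  have /periodic_basilica : iter (n - m).-1.+1 (quad (-1)) (x m) = x m.
    by rewrite prednK ?subn_gt0 // -iterD subnK // ltnW.
  move=> h; rewrite /P; set y := x m in h *.
  transitivity (y * (y + 1) * (y ^+ 2 - y - 1) *
    ((y - 1) * (y ^+ 2 - 2) * (y ^+ 2 + y - 1))); first by ring.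
  by rewrite h mul0r.
have sq2 (b : rat) : b ^+ 2 <> 2 by apply/eqP/(@prime_not_rat_square 2).
have sq5 (b : rat) : b ^+ 2 <> 5 by apply/eqP/(@prime_not_rat_square 5).
(* Descent along the orbit, from the periodic point [x m] back to [x 0 = a]. *)
suff down k : P R (x k.+1) = 0 -> P R (x k) = 0.
  by elim: (m) Pm => // k IHk /down.
rewrite xS; set y := x k => /eqP.
have yE : y = x k by [].
rewrite /P !mulf_eq0 -!orbA => /or4P[/eqP h|h|h|h].
- by rewrite h !(mulr0, mul0r).
- have : (y ^+ 2) * (y ^+ 2 - 2) = 0.
    by move/eqP: h => h; rewrite -[RHS]h; ring.
  move/eqP; rewrite mulf_eq0 expf_eq0 /= => /orP[] /eqP ->.
    by rewrite !mul0r.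
  by rewrite mulr0 !mul0r.
(* [(y^2 - 1)^2 = 2] reads [y^4 = 2 y^2 + 1]; a rational root [b] of [X^2 - 2X - 1] would give
   [(b - 1)^2 = 2]. *)
- have [|b hb] := @nosq k 2 1 isT.
    rewrite -yE rmorph1 ratr_nat; apply/eqP; rewrite -subr_eq0 -(eqP h).
    by apply/eqP; ring.
  by case: (sq2 (b - 1)); rewrite sqrrB hb; ring.
- have [h5|h5] := orP h.
    have : (y ^+ 2 - y - 1) * (y ^+ 2 + y - 1) = 0.
      by move/eqP: h5 => h5; rewrite -[RHS]h5; ring.
    by rewrite -mulrA => ->; rewrite mulr0.
  (* Now [y^4 = y^2 + 1], and a rational root [b] of [X^2 - X - 1] would give [(2b - 1)^2 = 5]. *)
  have [|b hb] := @nosq k 1 1 isT.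
    rewrite -yE rmorph1; apply/eqP; rewrite -subr_eq0 -(eqP h5).
    by apply/eqP; ring.
  case: (sq5 (2 * b - 1)); rewrite -[RHS](addr0 5).
  by move: hb => /eqP; rewrite -subr_eq0 => /eqP hb; rewrite -(mulr0 4) -hb; ring.
Qed.

End RationalPolynomials.

Theorem theorem1p2 (R : realType) :
  [/\ PrePer 'X^2 `&` Qtr R = [set 1; -1; 0],
      PrePer ('X^2 + (1 / 4)%:P) `&` Qtr R = [set 1 / 2; - (1 / 2)],
      PrePer ('X^2 - 1) `&` Qtr R =
        [set 0; 1; -1; sqrtC 2; - sqrtC 2;
             (-1 + sqrtC 5) / 2; (-1 - sqrtC 5) / 2;
             (1 + sqrtC 5) / 2; (1 - sqrtC 5) / 2] &
      PrePer ('X^2 + (1 / 5)%:P) `&` Qtr R =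
        [set (-1 + sqrtC 5) / (2 * sqrtC 5); (-1 - sqrtC 5) / (2 * sqrtC 5);
             (1 + sqrtC 5) / (2 * sqrtC 5); (1 - sqrtC 5) / (2 * sqrtC 5)]].
Proof.
have s2 : sqrtC 2 ^+ 2 = 2 :> algC by rewrite sqrtCK.
have s5 : sqrtC 5 ^+ 2 = 5 :> algC by rewrite sqrtCK.
have s50 : sqrtC 5 != 0 :> algC by rewrite sqrtC_eq0 pnatr_eq0.
(* Only the squares and [s != 0] matter from here on, so the roots become variables for [ring] and
   [field]. *)
move: (sqrtC 2) (sqrtC 5) s2 s5 s50 => r s r2 s2 s0.
have ratrV k : ratr (1 / k%:R) = 1 / k%:R :> algC.
  by rewrite !div1r fmorphV /= ratr_nat.
split; rewrite predeqE => x.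
- have -> : 'X^2 = 'X^2 + (ratr 0)%:P :> {poly algC} by rewrite rmorph0 addr0.
  rewrite PrePer_Qtr_quad ?rmorph0 /=; last by lra.
  have -> : (x ^+ 2 - x + 0) * (x ^+ 2 + x + 0) =
            x * ((x - 1) * (x - -1) * (x - 0)) by ring.
  split=> [/eqP|[[]|] ->]; last 3 first.
  1-3: by rewrite subrr !(mulr0, mul0r).
  rewrite !mulf_eq0 !subr_eq0 => /orP[/eqP ->|]; first by right.
  by move=> /orP[/orP[]|] /eqP ->; tauto.
- rewrite -(ratrV 4) PrePer_Qtr_quad ?ratrV; last by lra.
  have -> : (x ^+ 2 - x + 1 / 4) * (x ^+ 2 + x + 1 / 4) =
            ((x - 1 / 2) * (x - - (1 / 2))) ^+ 2 by field.
  split=> [/eqP|[] ->]; last 2 first.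
  1-2: by rewrite subrr !(mulr0, mul0r) expr0n.
  by rewrite expf_eq0 mulf_eq0 !subr_eq0 => /orP[] /eqP ->; rewrite /=; tauto.
- have -> : 'X^2 - 1 = 'X^2 + (ratr (-1))%:P :> {poly algC}.
    by rewrite rmorphN rmorph1 polyCN.
  rewrite PrePer_Qtr_basilica /=.
  have -> : x ^+ 2 - 2 = (x - r) * (x - - r) by rewrite -r2; ring.
  have -> : x ^+ 2 - x - 1 = (x - (1 + s) / 2) * (x - (1 - s) / 2).
    transitivity (x ^+ 2 - x + (1 - s ^+ 2) / 4); last by field.
    by rewrite s2; field.
  have -> : x ^+ 2 + x - 1 = (x - (-1 + s) / 2) * (x - (-1 - s) / 2).
    transitivity (x ^+ 2 + x + (1 - s ^+ 2) / 4); last by field.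
    by rewrite s2; field.
  have -> : x * (x ^+ 2 - 1) = (x - 0) * (x - 1) * (x - -1) by ring.
  split=> [/eqP|[[[[[[[[]|]|]|]|]|]|]|] ->]; last 9 first.
  1-9: by rewrite subrr !(mulr0, mul0r).
  rewrite !mulf_eq0 !subr_eq0 -!orbA.
  by do ![case/orP] => /eqP ->; tauto.
- rewrite -(ratrV 5) PrePer_Qtr_quad ?ratrV; last by lra.
  have -> : x ^+ 2 - x + 1 / 5 =
            (x - (1 + s) / (2 * s)) * (x - (-1 + s) / (2 * s)).
    (* Since [s^2 = 5], the constant [1 / 5] equals [(s^2 - 1) / (4 s^2)], the product of the two
       roots. *)
    transitivity (x ^+ 2 - x + (s ^+ 2 - 1) / (4 * s ^+ 2)); last by field.
    by rewrite s2; field.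
  have -> : x ^+ 2 + x + 1 / 5 =
            (x - (1 - s) / (2 * s)) * (x - (-1 - s) / (2 * s)).
    transitivity (x ^+ 2 + x + (s ^+ 2 - 1) / (4 * s ^+ 2)); last by field.
    by rewrite s2; field.
  split=> [/eqP|[[[]|]|] ->]; last 4 first.
  1-4: by rewrite subrr !(mulr0, mul0r).
  by rewrite !mulf_eq0 !subr_eq0 => /orP[] /orP[] /eqP ->; rewrite /=; tauto.
Qed.
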